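(* Assume $\int_{\{a(x)>1\}}\log a(x)\,d(F(x))<+\infty$. Then the function $u\mapsto \widetilde G_u(\overline t_u)$ is continuous and strictly decreasing on $(0,E)$. Its range (the set of values for $u\in(0,E)$) is $(1,+\infty)$ if $\xi\ge 0$, and is $\left(1,\ \exp\left(\int_I\log(a(x)\eta+1)\,d(F(x))\right)\right)$ if $\xi<0$, where $\eta:=\lim_{u\to0^+}\overline t_u/u$.
   Context: Setting: $I\subseteq\mathbb R$ is an interval, $F$ is a probability distribution function on $I$, and $\int_I g(x)\,d(F(x))$ is the Lebesgue–Stieltjes integral with respect to the associated probability measure. $a:I\to\mathbb R$ is measurable, $\xi:=\inf_{x\in I}a(x)>-\infty$, and $\xi$ is the essential infimum of $a$: $\int_{a(x)<\xi+\varepsilon}d(F(x))>0$ for all $\varepsilon>0$. $a$ is not a.e. constant: $\int_{a(x)<\xi+\delta}d(F(x))<1$ for some $\delta>0$. $E:=\int_I a(x)\,d(F(x))$ is assumed to satisfy $0<E\le+\infty$. $H:=\int_I \frac1{a(x)}d(F(x))$ (used when $\xi\ge0$) and $H_\xi:=\int_I\frac1{a(x)-\xi}d(F(x))\in(0,+\infty]$, with $1/0=+\infty$ (so $H_\xi=+\infty$ if $\{a=\xi\}$ has positive measure; likewise for $H=H_0$ when $\xi=0$) and $1/(+\infty)=0$. For $u>\max(0,\xi)$ and $0<t<u/(u-\xi)$ put $w_u(t):=\int_I\frac{a(x)-u}{a(x)t-ut+u}d(F(x))$. For $\max(0,\xi+1/H_\xi)<u<E$ the equation $w_u(t)=0$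 has a unique solution in $(0,u/(u-\xi))$, denoted $\widetilde t_u$ (pre-optimal proportion). For $u>0$, $\overline t_u$ is defined by: if $\xi\ge0$: $\overline t_u=1$ for $0<u\le 1/H$, $\overline t_u=\widetilde t_u$ for $1/H<u<E$, $\overline t_u=0$ for $u\ge E$; if $\xi<0$: $\overline t_u=\frac{u}{u-\xi}$ for $0<u\le\max(0,\xi+1/H_\xi)$, $\overline t_u=\widetilde t_u$ for $\max(0,\xi+1/H_\xi)<u<E$, $\overline t_u=0$ for $u\ge E$. $\widetilde G_u(t):=\exp\left(\int_I\log\left(a(x)t/u-t+1\right)d(F(x))\right)$ for $u\in(\max(0,\xi),E)$, $t\in(0,u/(u-\xi))$; it is extended by the same formula to $t=u/(u-\xi)$ (where it equals $\exp(\int_I\log(a(x)-\xi)d(F(x)))/(u-\xi)$) and, when $\xi>0$, to $0<u\le\xi$, $t>0$. *)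

(* Defs.v *)
From HB Require Import structures.
From mathcomp Require Import all_boot all_order all_algebra.
From mathcomp Require Import all_classical all_reals all_analysis.

Set Implicit Arguments.
Unset Strict Implicit.
Unset Printing Implicit Defensive.

Import Order.TTheory GRing.Theory Num.Theory.
Import numFieldNormedType.Exports.

Local Open Scope classical_set_scope.
Local Open Scope ring_scope.

Section game.
Context {R : realType}.
(* [F] is defined on the whole line; that it is a distribution function on the
   interval [I] is then the condition [lebesgue_stieltjes_measure F [set` I] = 1]. *)
Variables (F : cumulativeBounded (0 : R) (1 : R)) (I : interval R) (a : R -> R).

Local Notation P := (lebesgue_stieltjes_measure F).

Definition xi : R := inf (a @` [set` I]).

Definition mean : \bar R := (\int[P]_(x in [set` I]) (a x)%:E)%E.

(* The inverse is taken in [\bar R], where 0^-1 = +oo and +oo^-1 = 0. *)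
Definition H : \bar R := (\int[P]_(x in [set` I]) ((a x)%:E)^-1)%E.

Definition Hxi : \bar R :=
  (\int[P]_(x in [set` I]) ((a x - xi)%:E)^-1)%E.

Definition w (u t : R) : \bar R :=
  (\int[P]_(x in [set` I]) ((a x - u) / (a x * t - u * t + u))%:E)%E.

(* The zero of [w u] in ]0, u / (u - xi)[ if there is one, and 0 otherwise. *)
Definition preoptimal (u : R) : R :=
  xget 0 [set t | 0 < t < u / (u - xi) /\ w u t = 0%E].

Definition threshold : \bar R := maxe 0%E (xi%:E + Hxi^-1)%E.

Definition tbar (u : R) : R :=
  if 0 <= xi then
    if (u%:E <= H^-1)%E then 1
    else if (u%:E < mean)%E then preoptimal u else 0
  else
    if (u%:E <= threshold)%E then u / (u - xi)
    else if (u%:E < mean)%E then preoptimal u else 0.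

(* Logarithm and exponential are those of [\bar R]: log 0 = -oo, exp (-oo) = 0,
   unlike [ln], for which [ln 0 = 0]. *)
Definition G (u t : R) : \bar R :=
  expeR (\int[P]_(x in [set` I]) lne (a x * t / u - t + 1)%:E)%E.

Definition growth_sup (eta : R) : \bar R :=
  expeR (\int[P]_(x in [set` I]) lne (a x * eta + 1)%:E)%E.

Definition price_domain : set R := [set u | (0 < u%:E < mean)%E].

End game.

(* Main.v *)
Require Import Defs.
From HB Require Import structures.
From mathcomp Require Import all_boot all_order all_algebra.
From mathcomp Require Import all_classical all_reals all_analysis.
From mathcomp Require Import measurable_realfun ring lra.

(* Put c = min(xi, 0), b = a - c >= 0 and U = u - c > 0. With t = u / (U + r),
   the return a t / u - t + 1 becomes (b + r) / (U + r), so that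
   log G_u(t) = h(r) - ln (U + r) with h(r) = \int ln (b + r), and the price u
   enters only through the elementary term ln (U + r). Both regimes of tbar
   correspond to an r >= 0 with (U + r) \int 1 / (b + r) <= 1, with equality
   unless r = 0; by concavity of ln such an r maximizes h(r) - ln (U + r) over
   all r >= 0. Let V(U) be this maximum. Testing the maximality at one price
   against the maximizer of another price gives at once that V is strictly
   decreasing, that V(U) - V(U') <= ln U' - ln U for U < U' (whence the
   continuity), and that the maximizer is nondecreasing in U (whence the limit
   eta). The range is an interval by the intermediate value theorem. Its lower
   end is found from V(U) <= (\int b - U) / (U + r) if b is integrable and from
   V(U) <= \int ln (1 + b / U) otherwise; its upper end from the choice r = u if
   xi >= 0, and from the right continuity of h (monotone convergence) if
   xi < 0. *)

Set Implicit Arguments.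
Unset Strict Implicit.
Unset Printing Implicit Defensive.

Import Order.TTheory GRing.Theory Num.Theory.
Import numFieldNormedType.Exports.

Local Open Scope classical_set_scope.
Local Open Scope ring_scope.

(** * Tangent-line bounds for the logarithm *)

Lemma ln_le_subr1 (R : realType) (x : R) : 0 < x -> ln x <= x - 1.
Proof. by move=> x0; rewrite -[x in ln x](subrK 1) addrC; apply: le_ln1Dx; lra. Qed.

Lemma ln_ge_1subV (R : realType) (x : R) : 0 < x -> 1 - x^-1 <= ln x.
Proof.
move=> x0; have := @ln_le_subr1 R x^-1; rewrite invr_gt0 lnV ?posrE// => /(_ x0).
lra.
Qed.

(** * Integration *)

Section real_integrals.
Context d (T : measurableType d) (R : realType) (mu : {measure set T -> \bar R}).
Variables (D : set T).
Hypothesis mD : measurable D.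

(** [g - f] agrees almost everywhere with its absolute value, whose integral is nonnegative. *)
Lemma ae_le_Rintegral (f g : T -> R) :
  mu.-integrable D (EFin \o f) -> mu.-integrable D (EFin \o g) ->
  (\forall x \ae mu, D x -> f x <= g x) ->
  \int[mu]_(x in D) f x <= \int[mu]_(x in D) g x.
Proof.
move=> fi gi fg.
have ? : measurable_fun D f by exact/measurable_EFinP/(measurable_int mu).
have ? : measurable_fun D g by exact/measurable_EFinP/(measurable_int mu).
rewrite -subr_ge0 -RintegralB//.
rewrite (_ : \int[mu]_(x in D) (g x - f x) =
             \int[mu]_(x in D) `|g x - f x|); first exact: Rintegral_ge0.
congr fine; apply: ae_eq_integral => //.
- by apply/measurable_EFinP; exact: measurable_funB.
- apply/measurable_EFinP; apply: measurableT_comp => //.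
  exact: measurable_funB.
- by apply: filterS fg => x fgx Dx; rewrite ger0_norm ?subr_ge0// fgx.
Qed.

Lemma ae_le_integrable (f g : T -> R) : measurable_fun D f ->
  mu.-integrable D (EFin \o g) -> (\forall x \ae mu, D x -> `|f x| <= g x) ->
  mu.-integrable D (EFin \o f).
Proof.
move=> mf gi fg.
have mg : measurable_fun D g by exact/measurable_EFinP/(measurable_int mu).
apply/integrableP; split; first exact/measurable_EFinP.
have := gi => /integrableP[_]; apply: le_lt_trans.
apply: ae_ge0_le_integral => //.
- by apply: measurableT_comp => //; exact/measurable_EFinP.
- by apply: measurableT_comp => //; exact/measurable_EFinP.
- apply: filterS fg => x fgx Dx; rewrite /= lee_fin.
  by rewrite (le_trans (fgx Dx))// ler_norm.
Qed.

Lemma integrable_EFinD (f g : T -> R) :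
  mu.-integrable D (EFin \o f) -> mu.-integrable D (EFin \o g) ->
  mu.-integrable D (EFin \o (fun x => f x + g x)).
Proof. exact: integrableD. Qed.

Lemma integrable_EFinZl (c : R) (f : T -> R) :
  mu.-integrable D (EFin \o f) -> mu.-integrable D (EFin \o (fun x => c * f x)).
Proof. exact: integrableZl. Qed.

Hypothesis muD : mu D = 1%E.

Lemma integrable_const (r : R) : mu.-integrable D (EFin \o cst r).
Proof.
apply/integrableP; split; first exact/measurable_EFinP.
rewrite (_ : (fun x => _) = cst (`|r|)%:E)//.
by rewrite integral_cst// muD mule1 ltry.
Qed.

Lemma integral_EFin_const (r : R) : (\int[mu]_(x in D) r%:E = r%:E)%E.
Proof. by rewrite (integral_cst mu mD r%:E) muD mule1. Qed.

Lemma Rintegral_const (r : R) : \int[mu]_(x in D) r = r.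
Proof. by rewrite Rintegral_cst// muD mulr1. Qed.

End real_integrals.

(** On nonnegative reals the inverse is the power of exponent -1, also at 0, where both are 0. *)
Lemma measurable_fun_inv d (T : measurableType d) (R : realType) (D : set T)
    (f : T -> R) : measurable_fun D f -> (forall x, D x -> 0 <= f x) ->
  measurable_fun D (fun x => (f x)^-1).
Proof.
move=> mf f0; apply: (eq_measurable_fun (fun x => f x `^ (-1))).
  by move=> x /set_mem Dx; rewrite powR_inv1// f0.
exact: (measurableT_comp (measurable_powR (-1)) mf).
Qed.

Lemma measurable_fun_inve d (T : measurableType d) (R : realType) (D : set T)
    (f : T -> R) : measurable D -> measurable_fun D f ->
  (forall x, D x -> 0 <= f x) -> measurable_fun D (fun x => ((f x)%:E)^-1%E).
Proof.
move=> mD mf f0; under eq_fun do rewrite inver.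
apply: measurable_fun_if => //.
- by apply: measurable_fun_eqr.
- apply/measurable_EFinP; apply: (measurable_funS mD); first exact: subIsetl.
  exact: measurable_fun_inv.
Qed.

Lemma measurable_lne_EFin (R : realType) :
  measurable_fun [set: R] (fun r : R => lne r%:E).
Proof.
rewrite /lne; apply: measurable_fun_ifT.
- exact: measurable_fun_ler.
- exact: measurable_cst.
- by apply/measurable_EFinP; exact: measurable_ln.
Qed.

(** Monotone convergence in the form used by contradiction below: a uniform bound on the integrals
    passes to the limit function, which may take the value [+oo]. *)
Lemma monotone_convergence_le d (T : measurableType d) (R : realType)
    (mu : {measure set T -> \bar R}) (D : set T) (g : nat -> T -> \bar R)
    (f : T -> \bar R) (M : \bar R) : measurable D ->
  (forall n, measurable_fun D (g n)) ->
  (forall n x, D x -> (0 <= g n x)%E) ->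
  (forall x, D x -> nondecreasing_seq (g ^~ x)) ->
  (forall x, D x -> g n x @[n --> \oo] --> f x) ->
  (forall n, (\int[mu]_(x in D) g n x <= M)%E) ->
  (\int[mu]_(x in D) f x <= M)%E.
Proof.
move=> mD mg g0 ndg gf gM.
rewrite (eq_integral (fun x => limn (g ^~ x))); last first.
  by move=> x /set_mem Dx; apply/esym/cvg_lim => //; exact: gf.
rewrite monotone_convergence//; apply: lime_le; last exact: nearW.
apply: ereal_nondecreasing_is_cvgn => m n mn; apply: ge0_le_integral => //.
- by move=> x Dx; exact: g0.
- by move=> x Dx; exact: ndg.
Qed.

(** * Maximization of the logarithmic growth rate *)

Section log_utility.
Context d (T : measurableType d) (R : realType) (mu : {measure set T -> \bar R}).
Variables (D : set T) (b : T -> R).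
Hypotheses (mD : measurable D) (muD : mu D = 1%E) (mb : measurable_fun D b).
Hypothesis b_ge0 : forall x, D x -> 0 <= b x.
Hypothesis ln1b : mu.-integrable D (EFin \o (fun x => ln (b x + 1))).

(* Since [ln 0 = 0] and [0^-1 = 0], these two integrals are meaningful only when
   [b + r > 0] almost everywhere, which [admissible] requires. *)
Definition logint (r : R) : R := \int[mu]_(x in D) ln (b x + r).
Definition invint (r : R) : R := \int[mu]_(x in D) (b x + r)^-1.

Definition admissible (r : R) :=
  [/\ 0 <= r, \forall x \ae mu, D x -> 0 < b x + r &
      mu.-integrable D (EFin \o (fun x => ln (b x + r)))].

(** First-order condition for maximizing [logint r - ln (U + r)] over [r >= 0]: the formal
    derivative [invint r - (U + r)^-1] is at most 0, and it vanishes unless [r = 0]. *)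
Definition optimal (U r : R) :=
  [/\ admissible r, mu.-integrable D (EFin \o (fun x => (b x + r)^-1)),
      (U + r) * invint r <= 1 & r = 0 \/ (U + r) * invint r = 1].

Let mbD (r : R) : measurable_fun D (fun x => b x + r).
Proof. exact: measurable_funD. Qed.

Let mlnb (r : R) : measurable_fun D (fun x => ln (b x + r)).
Proof. by apply: (measurableT_comp (@measurable_ln R)). Qed.

Let cstI (r : R) : mu.-integrable D (EFin \o (fun=> r)).
Proof. exact: integrable_const. Qed.

Lemma bD_gt0 r x : 0 < r -> D x -> 0 < b x + r.
Proof. by move=> r0 /b_ge0 bx; lra. Qed.

(** [ln (b + r)] and [ln (b + 1)] differ by at most [|ln r|]. *)
Lemma pos_admissible r : 0 < r -> admissible r.
Proof.
move=> r0; split; first exact: ltW.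
  by apply: aeW => x; exact: bD_gt0.
pose g x := ln (b x + 1) + `|ln r|.
apply: (@ae_le_integrable _ _ _ _ _ mD _ g) => //.
  exact: integrable_EFinD.
apply: aeW => x Dx; rewrite /g; have bx := b_ge0 Dx.
have h1 : 0 <= ln (b x + 1) by apply: ln_ge0; lra.
have h2 : ln r <= ln (b x + r) by rewrite ler_ln ?posrE; lra.
have [r1|r1] := leP r 1.
  have h3 : ln (b x + r) <= ln (b x + 1) by rewrite ler_ln ?posrE; lra.
  have lnr := ln_le0 r1.
  by rewrite (ler0_norm lnr) ler_norml; apply/andP; split; lra.
have h3 : ln (b x + r) <= ln ((b x + 1) * r).
  rewrite ler_ln ?posrE; [nra|lra|nra].
rewrite lnM ?posrE in h3; [|lra|lra].
have h4 := ln_gt0 r1.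
by rewrite (ger0_norm (ltW h4)) ler_norml; apply/andP; split; lra.
Qed.

Lemma pos_inv_integrable r : 0 < r ->
  mu.-integrable D (EFin \o (fun x => (b x + r)^-1)).
Proof.
move=> r0.
apply: (@ae_le_integrable _ _ _ _ _ mD _ (cst r^-1)); last 2 first.
- exact: cstI.
- apply: aeW => x Dx; have bx := b_ge0 Dx.
  rewrite ger0_norm ?invr_ge0; last lra.
  by rewrite lef_pV2 ?posrE; lra.
by apply: measurable_fun_inv => // x Dx; exact/ltW/bD_gt0.
Qed.

(* Concavity: [ln y <= y - 1] at [y = (b + r') (U + r) / ((U + r') (b + r))]. *)
Lemma optimal_max U r r' : 0 < U -> optimal U r -> admissible r' ->
  logint r' - ln (U + r') <= logint r - ln (U + r).
Proof.
move=> U0 [[r0 rpos rint] iint krle kror] [r'0 r'pos r'int].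
pose c := (U + r) / (U + r').
have c0 : 0 < c by rewrite divr_gt0; lra.
have lnc : ln c = ln (U + r) - ln (U + r') by rewrite ln_div ?posrE; lra.
have I1 : mu.-integrable D (EFin \o (fun x => (c * (r' - r)) * (b x + r)^-1)).
  exact: integrable_EFinZl.
have I2 : mu.-integrable D (EFin \o (fun x => ln (b x + r) +
    ((c * (r' - r)) * (b x + r)^-1 + (c - 1 - ln c)))).
  apply: integrable_EFinD => //.
  exact: integrable_EFinD.
have : logint r' <= \int[mu]_(x in D) (ln (b x + r) +
    ((c * (r' - r)) * (b x + r)^-1 + (c - 1 - ln c))).
  apply: ae_le_Rintegral => //.
  apply: filterS2 rpos r'pos => x bx bx' Dx; move: (bx Dx) (bx' Dx) => {}bx {}bx'.
  have y0 : 0 < (b x + r') / (b x + r) * c by apply: mulr_gt0 => //; exact: divr_gt0.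
  have := ln_le_subr1 y0.
  have -> : ln ((b x + r') / (b x + r) * c) =
      ln (b x + r') - ln (b x + r) + ln c.
    by rewrite lnM ?posrE//; [rewrite ln_div ?posrE|exact: divr_gt0].
  have -> : (b x + r') / (b x + r) = 1 + (r' - r) * (b x + r)^-1 by field; lra.
  lra.
rewrite RintegralD//; last exact: integrable_EFinD.
rewrite RintegralD// RintegralZl// Rintegral_const// -/(logint r) -/(invint r).
suff : c * (1 + (r' - r) * invint r) <= 1 by rewrite lnc; lra.
rewrite -ler_pdivlMl// invf_div.
have -> : (U + r') / (U + r) * 1 = 1 + (r' - r) / (U + r) by field; lra.
(* If [r = 0] then [r' - r >= 0], and the upper bound on [invint r] suffices. Otherwise [r' - r] may
   have any sign, and the equality is used. *)
rewrite lerD2l; case: kror => [req0|kr].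
  apply: ler_wpM2l; first lra.
  by rewrite -[leRHS]mul1r ler_pdivlMr; lra.
suff -> : invint r = (U + r)^-1 by [].
by rewrite -[RHS]mulr1 -kr mulKf//; rewrite gt_eqF//; lra.
Qed.

(** Integrating [ln y >= 1 - y^-1] at [y = (b + r) / (U + r)] leaves the lower bound
    [1 - (U + r) * invint r]. *)
Lemma optimal_value_ge0 U r : 0 < U -> optimal U r ->
  0 <= logint r - ln (U + r).
Proof.
move=> U0 [[r0 rpos rint] iint krle kror].
have I1 : mu.-integrable D (EFin \o (fun x => (- (U + r)) * (b x + r)^-1)).
  exact: integrable_EFinZl.
have : \int[mu]_(x in D) ((- (U + r)) * (b x + r)^-1 + (1 + ln (U + r)))
    <= logint r.
  apply: ae_le_Rintegral => //.
    exact: integrable_EFinD.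
  apply: filterS rpos => x bx Dx; move: (bx Dx) => {}bx.
  have y0 : 0 < (b x + r) / (U + r) by rewrite divr_gt0; lra.
  have := ln_ge_1subV y0; rewrite ln_div ?posrE; [|lra|lra].
  by rewrite invf_div; lra.
rewrite RintegralD// RintegralZl// Rintegral_const// -/(invint r); lra.
Qed.
(** Passage from the extended logarithm to [ln]: they agree at positive arguments, hence almost
    everywhere by admissibility. *)
Lemma integral_lne_div r c : admissible r -> 0 < c ->
  (\int[mu]_(x in D) lne ((b x + r) / c)%:E = (logint r - ln c)%:E)%E.
Proof.
move=> [r0 rpos rint] c0; transitivity
    (\int[mu]_(x in D) (ln (b x + r) - ln c)%:E)%E.
  apply: ae_eq_integral => //.
  - apply: (measurableT_comp (@measurable_lne_EFin R)).
    by apply: measurable_funM.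
  - by apply/measurable_EFinP; exact: measurable_funB.
  - apply: filterS rpos => x bx Dx; have {}bx := bx Dx.
    by rewrite lne_EFin ?divr_gt0// ln_div.
rewrite /logint -[in RHS](Rintegral_const mD muD (ln c)) -RintegralB//.
rewrite /Rintegral fineK//; apply: integrable_fin_num => //.
exact: (@integrableB _ _ _ mu D mD (EFin \o _) (EFin \o _)).
Qed.

(** * Existence of an optimal shift *)

Let mVb : measurable_fun D (fun x => ((b x)%:E)^-1%E).
Proof. exact: measurable_fun_inve. Qed.

Let Vb_ge0 x : D x -> (0 <= ((b x)%:E)^-1)%E.
Proof. by move=> Dx; rewrite inve_ge0 lee_fin b_ge0. Qed.

Lemma integral_inve_ge0 : (0 <= \int[mu]_(x in D) ((b x)%:E)^-1)%E.
Proof. exact: integral_ge0. Qed.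

(** The hypothesis makes the extended inverse of [b] integrable. Hence [b > 0] almost everywhere,
    and [|ln b|] is dominated by [ln (b + 1) + b^-1]. *)
Lemma optimal0 U : 0 < U ->
  (U%:E <= (\int[mu]_(x in D) ((b x)%:E)^-1)^-1)%E -> optimal U 0.
Proof.
move=> U0; rewrite inve_pge ?inE ?lee_fin ?integral_inve_ge0 ?(ltW U0)//.
rewrite inver gt_eqF// => kU.
have kI : mu.-integrable D (fun x => ((b x)%:E)^-1%E).
  apply/integrableP; split => //.
  rewrite (eq_integral (fun x => ((b x)%:E)^-1%E)); last first.
    by move=> x /set_mem Dx; rewrite gee0_abs// Vb_ge0.
  exact: le_lt_trans kU (ltry _).
(* Where [b x = 0], the real inverse is 0 and the extended one is [+oo]. *)
have leV x : D x -> (((b x + 0)^-1)%:E <= ((b x)%:E)^-1)%E.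
  by move=> _; rewrite addr0 inver; case: ifP => [_|//]; exact: leey.
have V0 x : D x -> 0 <= (b x + 0)^-1.
  by move=> Dx; rewrite invr_ge0 addr0 b_ge0.
have vI : mu.-integrable D (EFin \o (fun x => (b x + 0)^-1)).
  apply: le_integrable kI => //.
    apply/measurable_EFinP; apply: measurable_fun_inv => // x Dx.
    by rewrite addr0 b_ge0.
  move=> x Dx; rewrite [leRHS]gee0_abs ?Vb_ge0// gee0_abs ?leV//.
  by rewrite lee_fin V0.
have bpos : \forall x \ae mu, D x -> 0 < b x + 0.
  apply: filterS (integrable_ae mD kI) => x + Dx => /(_ Dx).
  rewrite addr0 inver lt_neqAle b_ge0// andbT eq_sym.
  by case: ifP.
have kle : (U + 0) * invint 0 <= 1.
  rewrite addr0 mulrC -ler_pdivlMr// mul1r -lee_fin /invint /Rintegral fineK.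
    by apply: le_trans kU; apply: ge0_le_integral => //; exact: (measurable_int mu).
  exact: integrable_fin_num.
split => //; last by left.
split => //.
apply: (@ae_le_integrable _ _ _ _ _ mD _
  (fun x => ln (b x + 1) + (b x + 0)^-1)) => //.
  exact: integrable_EFinD.
apply: filterS bpos => x + Dx => /(_ Dx); rewrite addr0 => bx.
have h1 : 0 <= ln (b x + 1) by apply: ln_ge0; lra.
have h2 : ln (b x) <= ln (b x + 1) by rewrite ler_ln ?posrE; lra.
have h3 : 0 < (b x)^-1 by rewrite invr_gt0.
have h4 := ln_ge_1subV bx.
by rewrite ler_norml; apply/andP; split; lra.
Qed.

(** If [invint r <= M] for all [r > 0], monotone convergence along [r = 1 / (n + 1)] bounds the
    extended integral of [1 / b] by [M]. *)
Lemma invint_gt M : ((M%:E)%E < \int[mu]_(x in D) ((b x)%:E)^-1)%E ->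
  exists2 r, 0 < r & M < invint r.
Proof.
move=> Mlt; apply: contrapT => /forall2NP H; move: Mlt; apply/negP.
rewrite -leNgt.
apply: (@monotone_convergence_le _ _ _ _ _
  (fun n x => ((b x + n.+1%:R^-1)^-1)%:E)) => //.
- move=> n; apply/measurable_EFinP; apply: measurable_fun_inv => // x Dx.
  by apply/ltW/bD_gt0 => //; rewrite invr_gt0.
- by move=> n x Dx; rewrite lee_fin invr_ge0; apply/ltW/bD_gt0.
- move=> x Dx m n mn; rewrite lee_fin lef_pV2 ?posrE ?bD_gt0//.
  by rewrite lerD2l lef_pV2 ?posrE// ler_nat ltnS.
- move=> x Dx; rewrite inver; case: ifPn => [/eqP->|b0].
    apply/cvgeyPge => A; near=> n; rewrite lee_fin add0r invrK.
    apply: (@le_trans _ _ n%:R); last by rewrite ler_nat.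
    near: n; exact: nbhs_infty_ger.
  apply: cvg_EFin; first exact: nearW.
  apply: cvgV => //; rewrite -[X in _ --> X]addr0.
  by apply: cvgD; [exact: cvg_cst|exact: cvg_harmonic].
- move=> n; have [] := H n.+1%:R^-1; first by rewrite invr_gt0 ltr0n.
  move=> /negP; rewrite -leNgt -lee_fin /invint /Rintegral fineK//.
  by apply: integrable_fin_num => //; apply: pos_inv_integrable.
Unshelve. all: by end_near. Qed.
(** Suppose [(U + r) * invint r >= 1] for all [r > 0]. With [r = n + 1], the functions
    [r - r^2 / (b + r) = b r / (b + r)] increase to [b], and their integrals are at most
    [r - r^2 / (U + r)], which is at most [U]; so the integral of [b] is at most [U]. *)
Lemma invint_lt U : 0 < U -> (U%:E < \int[mu]_(x in D) (b x)%:E)%E ->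
  exists2 r, 0 < r & (U + r) * invint r < 1.
Proof.
move=> U0 Ult; apply: contrapT => /forall2NP H; move: Ult; apply/negP.
rewrite -leNgt.
pose g n x : R := n.+1%:R - (n.+1%:R ^+ 2) * (b x + n.+1%:R)^-1.
have gE n x : D x -> g n x = b x * (1 - b x * (b x + n.+1%:R)^-1).
  move=> Dx; rewrite /g; field.
  by rewrite gt_eqF// bD_gt0.
apply: (@monotone_convergence_le _ _ _ _ _ (fun n x => (g n x)%:E)) => //.
- move=> n; apply/measurable_EFinP; apply: measurable_funB => //.
  apply: measurable_funM => //; apply: measurable_fun_inv => // x Dx.
  by apply/ltW/bD_gt0.
- move=> n x Dx; rewrite lee_fin gE// mulr_ge0 ?b_ge0// subr_ge0.
  rewrite ler_pdivrMr ?bD_gt0// mul1r lerDl.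
  exact: ler0n.
- move=> x Dx m n mn; rewrite lee_fin !gE// ler_wpM2l ?b_ge0//.
  rewrite lerD2l lerN2 ler_wpM2l ?b_ge0// lef_pV2 ?posrE ?bD_gt0//.
  by rewrite lerD2l ler_nat ltnS.
- move=> x Dx; apply: cvg_EFin; first exact: nearW.
  have lim_g : (fun n => b x * (1 - b x * (b x + n.+1%:R)^-1)) @ \oo -->
      b x * (1 - b x * 0).
    apply: cvgM; first exact: cvg_cst.
    apply: cvgB; first exact: cvg_cst.
    apply: cvgM; first exact: cvg_cst.
    apply/(@cvgrPdist_le _ R) => e e0; near=> n.
    rewrite sub0r normrN ger0_norm ?invr_ge0 ?(ltW (bD_gt0 _ Dx))//.
    rewrite -[leRHS]invrK lef_pV2 ?posrE ?invr_gt0 ?bD_gt0//.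
    apply: (@le_trans _ _ n%:R); first by near: n; exact: nbhs_infty_ger.
    apply: (@le_trans _ _ n.+1%:R); first by rewrite ler_nat.
    by rewrite lerDr b_ge0.
  rewrite mulr0 subr0 mulr1 in lim_g.
  apply: cvg_trans lim_g; apply: near_eq_cvg; apply: nearW => n /=.
  by rewrite gE.
- move=> n; set r : R := n.+1%:R.
  have r0 : 0 < r by rewrite ltr0n.
  have := H r; rewrite r0 => -[//|] /negP; rewrite -leNgt => kr.
  have rI := pos_inv_integrable r0.
  have rI2 : mu.-integrable D (EFin \o (fun x => (- r ^+ 2) * (b x + r)^-1)).
    exact: integrable_EFinZl.
  have gI : mu.-integrable D (EFin \o (fun x => r + (- r ^+ 2) * (b x + r)^-1)).
    exact: integrable_EFinD.
  rewrite (eq_integral (fun x => (r + (- r ^+ 2) * (b x + r)^-1)%:E)); last first.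
    by move=> x _; rewrite /g mulNr.
  rewrite -[leLHS]fineK ?integrable_fin_num// lee_fin.
  rewrite [leLHS](RintegralD mD (cstI r) rI2) Rintegral_const// RintegralZl//.
  rewrite -/(invint r).
  have : (U + r)^-1 <= invint r by rewrite -[leLHS]mul1r ler_pdivrMr; [lra|lra].
  move=> k_ge; apply: (@le_trans _ _ (r + (- r ^+ 2) * (U + r)^-1)).
    by rewrite lerD2l !mulNr lerN2 ler_wpM2l ?sqr_ge0.
  have -> : r + (- r ^+ 2) * (U + r)^-1 = U - U ^+ 2 * (U + r)^-1 by field; lra.
  by rewrite gerBl mulr_ge0 ?sqr_ge0// invr_ge0; lra.
Unshelve. all: by end_near. Qed.

(** Continuity under the integral sign on []r / 2, r + 1[], where the integrand is bounded by
    [2 / r]. *)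
Lemma invint_continuous r : 0 < r -> {for r, continuous invint}.
Proof.
move=> r0.
have r2 : r \in `]r / 2, r + 1[%classic.
  by rewrite inE/= in_itv/=; apply/andP; split; lra.
apply: (@continuity_under_integral R _ _ mu (fun r x => (b x + r)^-1) D mD
  (r / 2) (r + 1) _ _ (cst (r / 2)^-1) _ _ r r2).
- by move=> s /=; rewrite in_itv/= => /andP[s0 _]; apply: pos_inv_integrable; lra.
- apply: aeW => x Dx s; rewrite inE/= in_itv/= => /andP[s0 _].
  have bs : b x + s != 0 by rewrite gt_eqF// bD_gt0//; lra.
  apply: cvgV => //; apply: cvgD; [exact: cvg_cst|exact: cvg_id].
- exact: cstI.
- move=> s /=; rewrite in_itv/= => /andP[s0 _]; apply: aeW => x Dx.
  have bx := b_ge0 Dx.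
  rewrite ger0_norm ?invr_ge0; last lra.
  by rewrite lef_pV2 ?posrE; lra.
Qed.

(** Intermediate value theorem for [(U + r) * invint r], which exceeds 1 at some [p] and is below 1
    at some [q]. The order of [p] and [q] is unknown, hence the two cases. *)
Lemma invint_root U : 0 < U ->
  ((\int[mu]_(x in D) ((b x)%:E)^-1)^-1 < U%:E)%E ->
  (U%:E < \int[mu]_(x in D) (b x)%:E)%E ->
  exists2 r, 0 < r & (U + r) * invint r = 1.
Proof.
move=> U0; rewrite inve_plt ?inE ?lee_fin ?integral_inve_ge0 ?(ltW U0)//.
rewrite inver gt_eqF// => /invint_gt[p p0 kp] /(invint_lt U0)[q q0 kq].
have kp1 : 1 < (U + p) * invint p.
  have := kp; rewrite -[U^-1]mul1r ltr_pdivrMr//.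
  have : 0 < invint p by apply: lt_trans kp; rewrite invr_gt0.
  nra.
pose f r := (U + r) * invint r.
have fcont r : 0 < r -> {for r, continuous f}.
  move=> r0; apply: cvgM; last exact: invint_continuous.
  by apply: cvgD; [exact: cvg_cst|exact: cvg_id].
have [pq|qp] := leP p q.
  have [| |c] := @IVT R f p q 1 pq.
  - apply: continuous_in_subspaceT => r; rewrite inE/= in_itv/= => /andP[pr _].
    by apply: fcont; lra.
  - by rewrite /f ge_min le_max (ltW kp1) (ltW kq) orbT.
  - by rewrite in_itv/= => /andP[pc _] fc; exists c => //; lra.
have [| |c] := @IVT R f q p 1 (ltW qp).
- apply: continuous_in_subspaceT => r; rewrite inE/= in_itv/= => /andP[pr _].
  by apply: fcont; lra.
- by rewrite /f ge_min le_max (ltW kp1) (ltW kq) orbT.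
- by rewrite in_itv/= => /andP[pc _] fc; exists c => //; lra.
Qed.

Lemma root_optimal U r : 0 < r -> (U + r) * invint r = 1 -> optimal U r.
Proof.
move=> r0 kr; split; [exact: pos_admissible|exact: pos_inv_integrable| |by right].
by rewrite kr.
Qed.
(** Covers nonpositive shifts, which a zero of [w] might a priori produce. *)
Lemma integrable_inv_bounded_away r m : 0 < m ->
  (forall x, D x -> m <= b x + r) ->
  mu.-integrable D (EFin \o (fun x => (b x + r)^-1)).
Proof.
move=> m0 mr; apply: (@ae_le_integrable _ _ _ _ _ mD _ (cst m^-1)).
- by apply: measurable_fun_inv => // x /mr; apply: le_trans; exact: ltW.
- exact: cstI.
- apply: aeW => x /mr mbr; rewrite ger0_norm ?invr_ge0; last lra.
  by rewrite lef_pV2 ?posrE; lra.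
Qed.

(* Convexity of the inverse: [b / U] is the convex combination of [1] and
   [(b + r) / (U + r)] with weights [- r / U] and [(U + r) / U]. *)
Lemma nonpositive_root U r m : 0 < U -> r <= 0 -> 0 < U + r -> 0 < m ->
  (forall x, D x -> m <= b x + r) -> (U + r) * invint r = 1 ->
  (U%:E <= (\int[mu]_(x in D) ((b x)%:E)^-1)^-1)%E.
Proof.
move=> U0 r0 Ur0 m0 mr kr.
rewrite inve_pge ?inE ?lee_fin ?integral_inve_ge0 ?(ltW U0)//.
rewrite inver gt_eqF//.
have rI := integrable_inv_bounded_away m0 mr.
(* The convexity inequality divided by [U] reads [1 / b <= A + B / (b + r)]. Since
   [invint r = 1 / (U + r)], the right side integrates to [1 / U]. *)
pose A := - r / U ^+ 2; pose B := (U + r) ^+ 2 / U ^+ 2.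
have BI : mu.-integrable D (EFin \o (fun x => B * (b x + r)^-1)).
  exact: integrable_EFinZl.
have gI : mu.-integrable D (EFin \o (fun x => A + B * (b x + r)^-1)).
  exact: integrable_EFinD.
apply: (@le_trans _ _ (\int[mu]_(x in D) (A + B * (b x + r)^-1)%:E)%E).
  apply: ge0_le_integral => //; first exact: (measurable_int mu).
  move=> x Dx; have mx := mr x Dx.
  rewrite inver gt_eqF; last lra.
  rewrite lee_fin -subr_ge0.
  have -> : A + B / (b x + r) - (b x)^-1 =
      (- r) * (b x - U) ^+ 2 / (U ^+ 2 * (b x + r) * b x).
    by rewrite /A /B; field; rewrite !gt_eqF//; lra.
  have U2 := sqr_ge0 U; have bU2 := sqr_ge0 (b x - U).
  by apply: divr_ge0; repeat (apply: mulr_ge0 => //); lra.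
rewrite -[leLHS]fineK ?integrable_fin_num// lee_fin.
rewrite [leLHS](RintegralD mD (cstI A) BI) Rintegral_const// RintegralZl//.
rewrite -/(invint r) /A /B.
have -> : invint r = (U + r)^-1.
  by rewrite -[RHS]mulr1 -kr mulKf// gt_eqF.
by rewrite le_eqVlt; apply/orP; left; apply/eqP; field; rewrite !gt_eqF.
Qed.

(** * Limiting behaviour of the growth rate *)

(** Monotone convergence applied to [ln (b + r0 + 1) - ln (b + r0 + 1 / (n + 1))]. The bound [m]
    keeps the integral of the limit finite, which forces [b + r0 > 0] almost everywhere. *)
Lemma logint_ge_right r0 m : 0 <= r0 ->
  (forall n, m <= logint (r0 + n.+1%:R^-1)) ->
  admissible r0 /\ m <= logint r0.
Proof.
move=> r0_ge0 mle.
pose q x := ln (b x + (r0 + 1)) - ln (b x + r0).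
pose g n x := ln (b x + (r0 + 1)) - ln (b x + (r0 + n.+1%:R^-1)).
(* [f] is the true limit; [q] differs from it where [b + r0 = 0], because of the default
   [ln 0 = 0]. *)
pose f x := if b x + r0 == 0 then +oo%E else (q x)%:E.
have invS n : 0 < (n.+1%:R^-1 : R) by rewrite invr_gt0.
have invS1 n : (n.+1%:R^-1 : R) <= 1 by rewrite invf_le1// ler1n.
have adm n : admissible (r0 + n.+1%:R^-1).
  by apply: pos_admissible; rewrite ltr_wpDl.
have adm1 : admissible (r0 + 1) by apply: pos_admissible; lra.
have [_ _ int1] := adm1.
have mq : measurable_fun D q by exact: measurable_funB.
have mf : measurable_fun D f.
  apply: measurable_fun_if => //.
  - by apply: measurable_fun_eqr.
  - by apply/measurable_EFinP; exact: (measurable_funS mD).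
have fle : (\int[mu]_(x in D) f x <= (logint (r0 + 1) - m)%:E)%E.
  apply: (@monotone_convergence_le _ _ _ _ _ (fun n x => (g n x)%:E)) => //.
  - by move=> n; apply/measurable_EFinP; exact: measurable_funB.
  - move=> n x Dx; have := b_ge0 Dx; rewrite lee_fin subr_ge0.
    by move: (n.+1%:R^-1) (invS n) (invS1 n) => s ? ? ?; rewrite ler_ln ?posrE; lra.
  - move=> x Dx i j ij; have bx := b_ge0 Dx.
    rewrite lee_fin lerD2l lerN2 ler_ln ?posrE ?ltr_wpDl// ?ltr_wpDl//.
    by rewrite !lerD2l lef_pV2 ?posrE// ler_nat ltnS.
  - move=> x Dx; rewrite /f /g; case: ifPn => [/eqP br|br].
      apply/cvgeyPge => A; near=> n; rewrite lee_fin !addrA br !add0r ln1 sub0r.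
      rewrite lnV ?posrE// opprK -[A]expRK ler_ln ?posrE ?expR_gt0//.
      apply: (@le_trans _ _ n%:R); last by rewrite ler_nat.
      by near: n; exact: nbhs_infty_ger.
    have brp : 0 < b x + r0.
      by rewrite lt_neqAle eq_sym br addr_ge0// b_ge0.
    apply: cvg_EFin; first exact: nearW.
    apply: cvgB; first exact: cvg_cst.
    apply: continuous_cvg; first exact: continuous_ln.
    apply: cvgD; first exact: cvg_cst.
    rewrite -[X in _ --> X]addr0.
    by apply: cvgD; [exact: cvg_cst|exact: cvg_harmonic].
  - move=> n; have [_ _ intn] := adm n.
    have gI : mu.-integrable D (EFin \o g n).
      exact: (@integrableB _ _ _ mu D mD (EFin \o _) (EFin \o _)).
    rewrite -[leLHS]fineK ?integrable_fin_num// lee_fin.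
    by rewrite [leLHS](RintegralB mD int1 intn) lerD2l lerN2 mle.
have f_ge0 x : D x -> (0 <= f x)%E.
  move=> Dx; rewrite /f; case: ifPn => // br.
  have brp : 0 < b x + r0.
    by rewrite lt_neqAle eq_sym br addr_ge0// b_ge0.
  by rewrite lee_fin subr_ge0 ler_ln ?posrE; lra.
have fI : mu.-integrable D f.
  apply/integrableP; split => //.
  rewrite (eq_integral f); last by move=> x /set_mem Dx; rewrite gee0_abs// f_ge0.
  exact: le_lt_trans fle (ltry _).
have brp : \forall x \ae mu, D x -> 0 < b x + r0.
  apply: filterS (integrable_ae mD fI) => x + Dx => /(_ Dx).
  rewrite /f; case: ifPn => // br _.
  by rewrite lt_neqAle eq_sym br addr_ge0// b_ge0.
have qf : \forall x \ae mu, D x -> (q x)%:E = f x.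
  by apply: filterS brp => x + Dx => /(_ Dx) bx; rewrite /f gt_eqF.
have qI : mu.-integrable D (EFin \o q).
  apply/integrableP; split; first exact/measurable_EFinP.
  have /integrableP[_] := fI; congr (_ < _)%E; apply: ge0_ae_eq_integral => //.
  - exact: measurableT_comp.
  - by apply: measurableT_comp => //; exact/measurable_EFinP.
  - by apply: filterS qf => x + Dx => /(_ Dx) <-.
have intE : mu.-integrable D (EFin \o (fun x => ln (b x + r0))).
  have -> : (fun x => ln (b x + r0)) = (fun x => ln (b x + (r0 + 1)) - q x).
    by apply/funext => x; rewrite /q subKr.
  exact: (@integrableB _ _ _ mu D mD (EFin \o _) (EFin \o _)).
split => //.
have qle : \int[mu]_(x in D) q x <= logint (r0 + 1) - m.
  rewrite -lee_fin /Rintegral fineK ?integrable_fin_num//.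
  apply: le_trans fle; rewrite le_eqVlt; apply/orP; left; apply/eqP.
  by apply: ae_eq_integral => //; exact/measurable_EFinP.
have : \int[mu]_(x in D) q x = logint (r0 + 1) - logint r0 by rewrite -RintegralB.
lra.
Unshelve. all: by end_near. Qed.

(** Integrate [ln y <= y - 1] at [y = (b + r) / (U + r)]. *)
Lemma logint_le_mean U r : 0 < U -> admissible r ->
  mu.-integrable D (EFin \o b) ->
  logint r - ln (U + r) <= (\int[mu]_(x in D) b x - U) / (U + r).
Proof.
move=> U0 [r0 rpos rint] bI.
have Ur : 0 < U + r by lra.
have I1 : mu.-integrable D (EFin \o (fun x => (U + r)^-1 * b x)).
  exact: integrable_EFinZl.
have : logint r <=
    \int[mu]_(x in D) ((U + r)^-1 * b x + (ln (U + r) - U / (U + r))).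
  apply: ae_le_Rintegral => //; first exact: integrable_EFinD.
  apply: filterS rpos => x + Dx => /(_ Dx) bx.
  have y0 : 0 < (b x + r) / (U + r) by rewrite divr_gt0.
  have := ln_le_subr1 y0; rewrite ln_div ?posrE//.
  have -> : (b x + r) / (U + r) = (U + r)^-1 * b x + (1 - U / (U + r)).
    by field; rewrite gt_eqF.
  lra.
rewrite RintegralD// RintegralZl// Rintegral_const//; lra.
Qed.

(** For [r >= 0], [(b + r) / (U + r) <= 1 + b / U], a bound independent of [r]. The integral of its
    logarithm tends to 0 as [U] grows, by domination by [ln (b + 1)]. *)
Lemma logint_le_large e : 0 < e -> exists2 U0, 0 < U0 &
  forall U r, U0 <= U -> admissible r -> logint r - ln (U + r) <= e.
Proof.
move=> e0.
pose f n x := ln (1 + b x / n.+1%:R).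
have mf n : measurable_fun D (f n).
  apply: (measurableT_comp (@measurable_ln R)); apply: measurable_funD => //.
  exact: measurable_funM.
have fle n x : D x -> `|f n x| <= ln (b x + 1).
  move=> Dx; have bx := b_ge0 Dx.
  have b1 : b x / n.+1%:R <= b x.
    by rewrite ler_pdivrMr// ler_peMr// ler1n.
  have b2 : 0 <= b x / n.+1%:R by rewrite divr_ge0.
  rewrite /f; move: (b x / n.+1%:R) b1 b2 => s s1 s0.
  by rewrite ger0_norm ?ln_ge0 ?lerDl// ler_ln ?posrE; lra.
have fI n : mu.-integrable D (EFin \o f n).
  apply: (@ae_le_integrable _ _ _ _ _ mD _ (fun x => ln (b x + 1))) => //.
  by apply: aeW => x; exact: fle.
have [| |_ _] := @dominated_convergence _ _ _ mu D mD (fun n => EFin \o f n)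
  (cst 0%E) (EFin \o (fun x => ln (b x + 1))) (fun n => measurable_int mu (fI n))
  (measurable_cst _) _ ln1b _.
- apply: aeW => x Dx; apply: cvg_EFin; first exact: nearW.
  rewrite -[X in _ --> X](@ln1 R); apply: continuous_cvg.
    by apply: continuous_ln.
  rewrite -[X in _ --> X]addr0; apply: cvgD; first exact: cvg_cst.
  rewrite -[X in _ --> X](mulr0 (b x)); apply: cvgM; first exact: cvg_cst.
  exact: cvg_harmonic.
- by apply: aeW => x n Dx; rewrite lee_fin fle.
rewrite integral0 => flim.
have : \forall n \near \oo, (\int[mu]_(x in D) (f n x)%:E < e%:E)%E.
  have := flim; move=> /fine_cvgP[_ /cvgr_lt/(_ _ e0)].
  apply: filterS => n /=; rewrite -lte_fin fineK//.
  exact: (integrable_fin_num mD (fI n)).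
move=> [N _ /(_ N (leqnn N))] /= fN.
exists N.+1%:R => // U r NU [r0 rpos rint].
have U0 : 0 < U by apply: lt_le_trans NU; rewrite ltr0n.
have : logint r <= \int[mu]_(x in D) (f N x + ln (U + r)).
  apply: ae_le_Rintegral => //; first exact: integrable_EFinD.
  apply: filterS rpos => x + Dx => /(_ Dx) bx.
  rewrite -lerBlDr -ln_div ?posrE//; last lra.
  have b0 := b_ge0 Dx.
  rewrite /f; set s := b x / N.+1%:R.
  have s0 : 0 <= s by rewrite divr_ge0.
  have sU : b x <= s * U.
    by rewrite -[leLHS](divfK (_ : N.+1%:R != 0)) ?pnatr_eq0// ler_wpM2l.
  move: s s0 sU => s s0 sU.
  rewrite ler_ln ?posrE ?divr_gt0//; [|lra|lra].
  by rewrite ler_pdivrMr; nra.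
rewrite RintegralD// Rintegral_const// => h.
have : \int[mu]_(x in D) f N x < e.
  by rewrite -lte_fin /Rintegral fineK//; exact: (integrable_fin_num mD (fI N)).
lra.
Qed.

(** [(b + u) / u] is at least [c / u] on the set where [c <= b], and at least 1 elsewhere. So
    [logint u - ln u] is at least [ln (c / u)] times the measure of that set. *)
Lemma logint_ge_small (c : R) : 0 < c ->
  (0 < mu (D `&` [set x | (c <= b x)%R]))%E ->
  forall M, exists2 u0, 0 < u0 &
    forall u, 0 < u <= u0 -> M <= logint u - ln (u + u).
Proof.
move=> c0; set A := D `&` _ => muA M.
have mA : measurable A.
  rewrite (_ : A = D `&` [set x | (c%:E <= (EFin \o b) x)%E]).
    by apply: emeasurable_fun_c_infty => //; exact/measurable_EFinP.
  by apply/seteqP; split => x /=; rewrite lee_fin.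
have AD : A `<=` D by exact: subIsetl.
have muAfin : mu A \is a fin_num.
  rewrite ge0_fin_numE// (@le_lt_trans _ _ (mu D))//; last by rewrite muD ltry.
  by apply: le_measure => //; rewrite inE.
pose p := fine (mu A).
have p0 : 0 < p by rewrite -lte_fin fineK.
(* Solves [p * ln (c / u) = |M| + ln 2] for [u]; the [ln 2] pays for [ln (u + u) - ln u]. *)
exists (c * expR (- (`|M| + ln 2) / p)) => [|u /andP[u0 ule]].
  by rewrite mulr_gt0// expR_gt0.
have uc : (`|M| + ln 2) / p <= ln (c / u).
  rewrite -ler_expR lnK ?posrE ?divr_gt0// ler_pdivlMr//.
  rewrite -ler_pdivlMl ?expR_gt0// mulrC -expRN.
  by rewrite -mulNr.
have ln2 : 0 < ln (2 : R) by apply: ln_gt0; lra.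
have lnc0 : 0 <= ln (c / u).
  by apply: le_trans uc; rewrite divr_ge0 ?addr_ge0// ltW.
have [_ _ uint] := pos_admissible u0.
have I1 : mu.-integrable D (EFin \o \1_A).
  apply: (@ae_le_integrable _ _ _ _ _ mD _ (cst 1)) => //; first exact: cstI.
  apply: aeW => x _; rewrite indicE; case: (_ \in _) => /=.
    by rewrite normr1.
  by rewrite normr0.
have IA : mu.-integrable D (EFin \o (fun x => ln (c / u) * \1_A x)).
  exact: integrable_EFinZl.
have : \int[mu]_(x in D) (ln (c / u) * \1_A x + ln u) <= logint u.
  apply: ae_le_Rintegral => //; first exact: integrable_EFinD.
  apply: aeW => x Dx; have bx := b_ge0 Dx.
  rewrite indicE; have [/set_mem[_ /= cb]|_] := boolP (x \in A).
    rewrite mulr1 ln_div ?posrE// subrK ler_ln ?posrE; lra.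
  by rewrite mulr0 add0r ler_ln ?posrE; lra.
rewrite RintegralD// Rintegral_const//.
have -> : \int[mu]_(x in D) (ln (c / u) * \1_A x) = ln (c / u) * p.
  by rewrite RintegralZl// /Rintegral integral_indic// (setIidl AD).
have : ln (u + u) = ln 2 + ln u.
  by rewrite -lnM ?posrE//; congr ln; ring.
have : `|M| + ln 2 <= ln (c / u) * p by rewrite -ler_pdivrMr.
have := ler_norm M.
lra.
Qed.

(** * Comparison of the optima at two prices *)

Lemma le_logint r s : admissible r -> admissible s -> r <= s ->
  logint r <= logint s.
Proof.
move=> [r0 rpos rint] [_ _ sint] rs; apply: ae_le_Rintegral => //.
by apply: filterS rpos => x + Dx => /(_ Dx) bx; rewrite ler_ln ?posrE; lra.
Qed.

(** [r'] competes with [r] at [U], and [- ln (U + r')] strictly decreases in [U]. *)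
Lemma optimal_value_lt U U' r r' : 0 < U -> U < U' ->
  optimal U r -> optimal U' r' ->
  logint r' - ln (U' + r') < logint r - ln (U + r).
Proof.
move=> U0 UU' ro [r'a _ _ _]; have [r'0 _ _] := r'a.
have := optimal_max U0 ro r'a.
have : ln (U + r') < ln (U' + r') by rewrite ltr_ln ?posrE; lra.
lra.
Qed.

(** Now [r] competes at [U']; the loss is controlled by [(U' + r) / (U + r) <= U' / U]. *)
Lemma optimal_value_le_ln U U' r r' : 0 < U -> U < U' ->
  optimal U r -> optimal U' r' ->
  logint r - ln (U + r) <= logint r' - ln (U' + r') + (ln U' - ln U).
Proof.
move=> U0 UU' [ra _ _ _] r'o; have [r0 _ _] := ra.
have := optimal_max (lt_trans U0 UU') r'o ra.
suff : ln (U' + r) + ln U <= ln (U + r) + ln U' by lra.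
rewrite -!lnM ?posrE; [|lra|lra|lra|lra].
by rewrite ler_ln ?posrE; nra.
Qed.

(** The two maximality inequalities add up to [(U + r) (U' + r') <= (U + r') (U' + r)], that is,
    [(U' - U) (r - r') <= 0]. *)
Lemma le_optimal U U' r r' : 0 < U -> U < U' ->
  optimal U r -> optimal U' r' -> r <= r'.
Proof.
move=> U0 UU' ro r'o; rewrite leNgt; apply/negP => r'r.
have [ra _ _ _] := ro; have [r'a _ _ _] := r'o.
have [r0 _ _] := ra; have [r'0 _ _] := r'a.
have h1 := optimal_max U0 ro r'a.
have h2 := optimal_max (lt_trans U0 UU') r'o ra.
have : ln (U + r) + ln (U' + r') <= ln (U + r') + ln (U' + r) by lra.
rewrite -!lnM ?posrE; [|lra|lra|lra|lra].
by rewrite ler_ln ?posrE; nra.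
Qed.

(** * The maximum as a function of the price *)

Section optimal_path.
Variables (c : R) (r : R -> R).
(** For [b = a - c] this is the mean of [a], and [dom] is then the set of prices below it. *)
Let E : \bar R := ((\int[mu]_(x in D) (b x)%:E) + c%:E)%E.
Let dom : set R := [set u | (0 < u%:E < E)%E].
Hypothesis c_le0 : c <= 0.
Hypothesis E_gt0 : (0 < E)%E.
Hypothesis ropt : forall u, dom u -> optimal (u - c) (r u).

Let v (u : R) : R := logint (r u) - ln (u - c + r u).

Let dom_gt0 u : dom u -> 0 < u.
Proof. by move=> /andP[]; rewrite lte_fin. Qed.

Let domW u u' : dom u -> 0 < u' -> u' <= u -> dom u'.
Proof.
move=> /andP[_ uE] u'0 u'u; rewrite /dom/= lte_fin u'0/=.
by apply: le_lt_trans uE; rewrite lee_fin.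
Qed.

Let dom_half u : dom u -> dom (u / 2).
Proof. by move=> du; have u0 := dom_gt0 du; apply: domW du _ _; lra. Qed.

Lemma dom_open : open dom.
Proof.
rewrite /dom; case: E => [e| |].
- rewrite (_ : [set _ | _] = `]0, e[%classic); first exact: interval_open.
  by apply/seteqP; split => u /=; rewrite in_itv/= !lte_fin.
- rewrite (_ : [set _ | _] = `]0, +oo[%classic); first exact: interval_open.
  by apply/seteqP; split => u /=; rewrite in_itv/= lte_fin ltry.
- rewrite (_ : [set _ | _] = set0); first exact: open0.
  by apply/seteqP; split => u //= /andP[].
Qed.

Lemma dom_nonempty : exists u, dom u.
Proof.
move: E_gt0; rewrite /dom; case: E => [e| |//].
  rewrite lte_fin => e0; exists (e / 2) => /=.
  by rewrite !lte_fin; apply/andP; split; lra.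
by move=> _; exists 1 => /=; rewrite lte_fin ltr01 ltry.
Qed.

Lemma dom_above u : dom u -> exists2 u', dom u' & u < u'.
Proof.
rewrite /dom; case: E => [e| |] /=.
- rewrite !lte_fin => /andP[u0 ue]; exists ((u + e) / 2); last lra.
  by rewrite !lte_fin; apply/andP; split; lra.
- rewrite !lte_fin => /andP[u0 _]; exists (u + 1); last lra.
  by rewrite lte_fin ltry andbT; lra.
- by move=> /andP[].
Qed.

Lemma value_lt u u' : dom u -> dom u' -> u < u' -> v u' < v u.
Proof.
move=> du du' uu'; have u0 := dom_gt0 du; have c0 := c_le0.
by apply: optimal_value_lt (ropt du) (ropt du'); lra.
Qed.

(** The two comparisons squeeze [|v s - v u|] below [|ln (s - c) - ln (u - c)|]. *)
Lemma value_continuous : {in dom, continuous v}.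
Proof.
move=> u /set_mem du; have u0 := dom_gt0 du; have c0 := c_le0.
have lnc : ln (s - c) @[s --> u] --> ln (u - c).
  apply: continuous_cvg; first by apply: continuous_ln; lra.
  by apply: cvgB; [exact: cvg_id|exact: cvg_cst].
apply/(@cvgrPdist_le _ R) => e e0.
move/(@cvgrPdist_le _ R)/(_ e e0): lnc => lnc.
have du_nbhs : \forall s \near u, dom s.
  exact: (open_nbhs_nbhs (conj dom_open du)).
apply: filterS2 du_nbhs lnc => s ds; rewrite ler_norml => /andP[lns1 lns2].
have s0 := dom_gt0 ds.
have [us|su|->] := ltgtP u s; last by rewrite subrr normr0 ltW.
  have h1 := value_lt du ds us.
  have h2 : v u <= v s + (ln (s - c) - ln (u - c)).
    by apply: optimal_value_le_ln (ropt du) (ropt ds); lra.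
  by rewrite ler_norml; apply/andP; split; lra.
have h1 := value_lt ds du su.
have h2 : v s <= v u + (ln (u - c) - ln (s - c)).
  by apply: optimal_value_le_ln (ropt ds) (ropt du); lra.
by rewrite ler_norml; apply/andP; split; lra.
Qed.

(** The value is nonnegative at a still larger price of [dom], hence positive at [u]. *)
Lemma value_gt0 u : dom u -> 0 < v u.
Proof.
move=> du; have u0 := dom_gt0 du; have c0 := c_le0.
have [u' du' uu'] := dom_above du.
apply: le_lt_trans (value_lt du du' uu').
by apply: optimal_value_ge0 (ropt du'); have := dom_gt0 du'; lra.
Qed.

Lemma value_arbitrarily_small e : 0 < e -> exists2 u, dom u & v u <= e.
Proof.
move=> e0; have [bI|bNI] := pselect (mu.-integrable D (EFin \o b)).
  pose m := \int[mu]_(x in D) b x + c.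
  have Em : E = m%:E.
    by rewrite /E /m EFinD /Rintegral fineK//; exact: (integrable_fin_num mD bI).
  have m0 : 0 < m by move: E_gt0; rewrite Em lte_fin.
  (* With this price the bound of [logint_le_mean] is [u * e / (u - c + r u)], at most [e]. *)
  pose u := m / (1 + e).
  have um : m = u * (1 + e) by rewrite /u divfK//; lra.
  have u0 : 0 < u by rewrite divr_gt0//; lra.
  have du : dom u.
    by rewrite /dom/= Em !lte_fin u0 um; nra.
  exists u => //.
  have c0 := c_le0; have [ra _ _ _] := ropt du; have [r0 _ _] := ra.
  have Uc : 0 < u - c by lra.
  apply: le_trans (logint_le_mean Uc ra bI) _.
  rewrite ler_pdivrMr; last lra.
  have -> : \int[mu]_(x in D) b x - (u - c) = u * e.
    have -> : \int[mu]_(x in D) b x = m - c by rewrite /m addrK.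
    by clearbody u; lra.
  nra.
(* Without integrability of [b >= 0] the mean is infinite, so arbitrarily large prices lie in
   [dom]. *)
have Eoo : E = +oo%E.
  rewrite /E (_ : (\int[mu]_(x in D) (b x)%:E)%E = +oo%E)//.
  apply/eqP; rewrite -leye_eq leNgt; apply/negP => h; apply: bNI.
  apply/integrableP; split; first exact/measurable_EFinP.
  rewrite (eq_integral (EFin \o b))// => x /set_mem Dx.
  by rewrite gee0_abs//= lee_fin b_ge0.
have [U0 U00 HU] := logint_le_large e0.
have du : dom U0 by rewrite /dom/= Eoo lte_fin U00 ltry.
have c0 := c_le0; exists U0 => //; apply: HU; first lra.
by have [] := ropt du.
Qed.

Lemma value_onto y : 0 < y -> (exists2 u, dom u & y <= v u) ->
  exists2 u, dom u & v u = y.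
Proof.
move=> y0 [p dp yp]; have y2 : 0 < y / 2 by lra.
have [q dq vq] := value_arbitrarily_small y2.
have pq : p < q.
  rewrite ltNge; apply/negP; rewrite le_eqVlt => /orP[/eqP qp|/(value_lt dq dp)].
    by move: vq; rewrite qp; lra.
  lra.
have sub : `[p, q]%classic `<=` dom.
  move=> s /=; rewrite in_itv/= => /andP[ps sq].
  by apply: domW dq _ sq; apply: lt_le_trans ps; exact: dom_gt0.
have [| |s sI vs] := @IVT R v p q y (ltW pq).
- apply: continuous_in_subspaceT => s /set_mem sI.
  by apply: value_continuous; rewrite inE; exact: sub.
- by rewrite ge_min le_max yp; apply/andP; split => //; apply/orP; right; lra.
- by exists s => //; apply: sub.
Qed.
(** The maximum at a small price [u] dominates the value of the shift [u] itself. *)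
Lemma value_unbounded (e : R) : c = 0 -> 0 < e ->
  (0 < mu (D `&` [set x | (e <= b x)%R]))%E ->
  forall M, exists2 u, dom u & M <= v u.
Proof.
move=> c0 e0 mue M; have [u0 u00 Hu] := logint_ge_small e0 mue M.
have [p dp] := dom_nonempty; have p0 := dom_gt0 dp.
pose u := Num.min u0 p.
have u_gt0 : 0 < u by rewrite lt_min u00.
have du : dom u by apply: domW dp u_gt0 _; rewrite ge_min lexx orbT.
exists u => //; apply: (@le_trans _ _ (logint u - ln (u - c + u))).
  by rewrite c0 subr0; apply: Hu; rewrite u_gt0 ge_min lexx.
apply: optimal_max (ropt du) (pos_admissible u_gt0).
by rewrite c0 subr0.
Qed.

(** [r0] is the infimum of the path, which is its right limit at 0 because the path is
    nondecreasing. *)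
Lemma path_limit : c < 0 -> exists r0, [/\ r u @[u --> 0^'+] --> r0,
  admissible r0,
  forall u, dom u -> v u < logint r0 - ln (- c + r0) &
  forall y, y < logint r0 - ln (- c + r0) -> exists2 u, dom u & y <= v u].
Proof.
move=> c0; have [p dp] := dom_nonempty; have p0 := dom_gt0 dp.
have rge0 u : dom u -> 0 <= r u by move=> du; have [[]] := ropt du.
have rmono u u' : dom u -> dom u' -> u <= u' -> r u <= r u'.
  move=> du du'; rewrite le_eqVlt => /orP[/eqP->//|uu'].
  have ? := dom_gt0 du.
  by apply: (@le_optimal (u - c) (u' - c)) (ropt du) (ropt du'); lra.
pose r0 := inf (r @` dom).
have rinf : has_inf (r @` dom).
  split; first by exists (r p); exists p.
  by exists 0 => _ [u du <-]; exact: rge0.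
have r0le u : dom u -> r0 <= r u.
  by move=> du; apply: inf_lbound; [case: rinf|exists u].
have r0_ge0 : 0 <= r0.
  by apply: lb_le_inf; [case: rinf|move=> _ [u du <-]; exact: rge0].
have rnear e : 0 < e -> exists2 u, dom u & r u < r0 + e.
  by move=> e0; have [_ [u du <-] ?] := inf_adherent e0 rinf; exists u.
(* A price [z] below both [u] and a price [s] with [r s < r0 + 1 / (n + 1)] gives [logint (r0 + 1 /
   (n + 1)) >= logint (r z) >= v u + ln (- c + r0)]. Then [n] tends to infinity. *)
have right_bound u : dom u -> admissible r0 /\ v u + ln (- c + r0) <= logint r0.
  move=> du; apply: logint_ge_right => // n.
  have nV : 0 < (n.+1%:R^-1 : R) by rewrite invr_gt0.
  have [s ds sr] := rnear _ nV.
  pose z := Num.min s u.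
  have [s0 u0] := (dom_gt0 ds, dom_gt0 du).
  have z0 : 0 < z by rewrite lt_min s0.
  have dz : dom z by apply: domW ds z0 _; rewrite ge_min lexx.
  have rzs : r z <= r s by apply: rmono => //; rewrite ge_min lexx.
  have [rza _ _ _] := ropt dz.
  have sa : admissible (r0 + n.+1%:R^-1) by apply: pos_admissible; rewrite ltr_wpDl.
  have : logint (r z) <= logint (r0 + n.+1%:R^-1).
    by apply: le_logint => //; exact/ltW/(le_lt_trans rzs).
  apply: le_trans.
  have vzu : v u <= v z.
    have : z <= u by rewrite ge_min lexx orbT.
    by rewrite le_eqVlt => /orP[/eqP ->//|/(value_lt dz du)/ltW].
  have r0z := r0le _ dz.
  have : ln (- c + r0) <= ln (z - c + r z) by rewrite ler_ln ?posrE; lra.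
  by move: vzu; rewrite [v z]/v; lra.
have cr0 : 0 < - c + r0 by lra.
have r0a : admissible r0 by have [] := right_bound _ dp.
exists r0; split => //.
- apply/(@cvgrPdist_le _ R) => e e0; have [s ds sr] := rnear _ e0.
  have s0 := dom_gt0 ds.
  near=> u.
  have u0 : 0 < u by near: u; exact: nbhs_right_gt.
  have us : u <= s by near: u; exact: nbhs_right_le.
  have du : dom u by exact: domW ds u0 us.
  have h1 := rmono _ _ du ds us; have h2 := r0le _ du.
  by rewrite ler_norml; apply/andP; split; lra.
- move=> u du; have u0 := dom_gt0 du.
  (* The weak bound at [u / 2] becomes strict at [u]. *)
  have [_ h] := right_bound _ (dom_half du).
  have uu : u / 2 < u by lra.
  by have := value_lt (dom_half du) du uu; lra.
- move=> y yS; set S := logint r0 - ln (- c + r0) in yS.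
  (* The price at which the fixed shift [r0] yields exactly [y]; any price up to [w] yields at least
     [y]. *)
  pose w := (- c + r0) * (expR (S - y) - 1).
  have w0 : 0 < w by apply: mulr_gt0 => //; rewrite subr_gt0 expR_gt1 subr_gt0.
  pose u := Num.min w p.
  have u0 : 0 < u by rewrite lt_min w0.
  have du : dom u by apply: domW dp u0 _; rewrite ge_min lexx orbT.
  have uw : u <= w by rewrite ge_min lexx.
  exists u => //.
  apply: (@le_trans _ _ (logint r0 - ln (u - c + r0))); last first.
    by apply: optimal_max (ropt du) r0a; lra.
  have : ln (u - c + r0) <= ln ((- c + r0) * expR (S - y)).
    rewrite ler_ln ?posrE; [|lra|by rewrite mulr_gt0 ?expR_gt0].
    by move: uw; rewrite /w; lra.
  rewrite lnM ?posrE ?expR_gt0//.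
  by rewrite expRK /S; lra.
Unshelve. all: by end_near. Qed.
End optimal_path.
End log_utility.

(** If [f] is not integrable, its integral is [+oo]; then the positive part of [f + c] has infinite
    integral, while that of its negative part is at most [- c]. *)
Lemma integral_addr_const d (T : measurableType d) (R : realType)
    (mu : {measure set T -> \bar R}) (D : set T) (f : T -> R) (c : R) :
  measurable D -> mu D = 1%E -> measurable_fun D f ->
  (forall x, D x -> 0 <= f x) -> c <= 0 ->
  (\int[mu]_(x in D) (f x + c)%:E = \int[mu]_(x in D) (f x)%:E + c%:E)%E.
Proof.
move=> mD muD mf f0 c0.
have intc := integral_EFin_const mD muD.
have [fI|fNI] := pselect (mu.-integrable D (EFin \o f)).
  have /= := integralD_EFin mD fI (integrable_const mD muD c).
  by rewrite intc => <-.
have foo : (\int[mu]_(x in D) (f x)%:E = +oo)%E.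
  apply/eqP; rewrite -leye_eq leNgt; apply/negP => h; apply: fNI.
  apply/integrableP; split; first exact/measurable_EFinP.
  rewrite (eq_integral (EFin \o f))// => x /set_mem Dx.
  by rewrite gee0_abs//= lee_fin f0.
rewrite foo integralE.
have mg : measurable_fun D (fun x => (f x + c)%:E).
  by apply/measurable_EFinP; exact: measurable_funD.
have neg_le : (\int[mu]_(x in D) (fun x => (f x + c)%:E)^\- x <= (- c)%:E)%E.
  rewrite -[leRHS]intc; apply: ge0_le_integral => //.
  - exact: measurable_funeneg.
  - move=> x Dx; rewrite funenegE -EFinN -EFin_max lee_fin ge_max.
    by have := f0 x Dx => ?; apply/andP; split; lra.
have pos_oo : (\int[mu]_(x in D) (fun x => (f x + c)%:E)^\+ x = +oo)%E.
  apply/eqP; rewrite -leye_eq -foo.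
  have : (\int[mu]_(x in D) (f x)%:E <=
      \int[mu]_(x in D) ((fun x => (f x + c)%:E)^\+ x + (- c)%:E))%E.
    apply: ge0_le_integral => //.
    - exact/measurable_EFinP.
    - apply: emeasurable_funD => //; exact: measurable_funepos.
    - move=> x Dx; rewrite funeposE -EFin_max -EFinD lee_fin.
      by rewrite -lerBlDr opprK le_max lexx.
  rewrite ge0_integralD//; last 2 first.
  - exact: measurable_funepos.
  - by move=> x _; rewrite lee_fin oppr_ge0.
  rewrite intc foo; case: (integral _ _ _) => //.
rewrite pos_oo addye//; move: neg_le; case: (integral _ _ _) => //.
Qed.

(** * The pre-optimal proportion as a maximizer *)

Section game_facts.
Context (R : realType) (F : cumulativeBounded (0 : R) (1 : R)).
Variables (I : interval R) (a : R -> R).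

Let P := lebesgue_stieltjes_measure F.
Let S := [set` I].
Let xi := Defs.xi I a.
Let E := mean F I a.
Let tb := tbar F I a.

Hypothesis PS : P S = 1%E.
Hypothesis ma : measurable_fun S a.
Hypothesis a_lb : has_lbound (a @` S).

(** The constant of the substitution [b = a - c], chosen so that [c <= 0] and [b >= 0] in both
    regimes. *)
Definition xi_min0 : R := Num.min xi 0.
Let c := xi_min0.
Let b x := a x - c.

Let mS : measurable (S : set (measurableTypeR R)).
Proof. exact: measurable_itv. Qed.

Let mb : measurable_fun S b.
Proof. exact: measurable_funB. Qed.

Let c_le0 : c <= 0. Proof. by rewrite /c /xi_min0 ge_min lexx orbT. Qed.

Let c_xi : c <= xi. Proof. by rewrite /c /xi_min0 ge_min lexx. Qed.

Lemma xi_le x : S x -> xi <= a x.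
Proof. by move=> Sx; apply: ge_inf => //; exists x. Qed.

Let b_ge0 x : S x -> 0 <= b x.
Proof. by move=> Sx; rewrite /b subr_ge0 (le_trans c_xi)// xi_le. Qed.

Lemma mean_shift : E = (\int[P]_(x in S) (b x)%:E + c%:E)%E.
Proof.
rewrite -(integral_addr_const mS PS mb b_ge0 c_le0).
by apply: eq_integral => x _; rewrite /b subrK.
Qed.

(** [ln (b + 1)] is at most [max (ln a) 0 + ln (2 - c)]: use [b + 1 <= 2 - c] if [a <= 1], and
    [b + 1 <= a (2 - c)] if [a > 1]. *)
Lemma integrable_ln1p_shift :
  (\int[P]_(x in [set x | x \in I /\ (1 < a x)%R]) (ln (a x))%:E < +oo)%E ->
  P.-integrable S (EFin \o (fun x => ln (b x + 1))).
Proof.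
move=> lnoo; pose g x := Num.max (ln (a x)) 0.
have mlna : measurable_fun S (fun x => ln (a x)).
  exact: (measurableT_comp (@measurable_ln R) ma).
have mg : measurable_fun S g by exact: measurable_maxr.
have gI : P.-integrable S (EFin \o g).
  apply/integrableP; split; first exact/measurable_EFinP.
  move: lnoo; congr (_ < _)%E.
  rewrite (_ : [set x | _] = S `&` [set x | 1 < a x])//.
  rewrite integral_mkcondr; apply: eq_integral => x _.
  rewrite /patch /=; case: ifPn => [|xn].
    move=> /set_mem/= /ln_gt0 l0; rewrite /g max_l ?ltW//.
    by rewrite gtr0_norm.
  rewrite /g max_r ?normr0//; apply: ln_le0; rewrite leNgt.
  by apply: contra xn => ?; rewrite inE.
apply: (@ae_le_integrable _ _ _ _ _ mS _ (fun x => g x + ln (2 - c))).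
- by apply: (measurableT_comp (@measurable_ln R)); exact: measurable_funD.
- by apply: integrable_EFinD => //; exact: integrable_const.
apply: aeW => x Sx; have bx := b_ge0 Sx; have c0 := c_le0.
rewrite ger0_norm; last by apply: ln_ge0; lra.
have [a1|a1] := leP (a x) 1.
  apply: (@le_trans _ _ (ln (2 - c))).
    by rewrite ler_ln ?posrE /b; move: bx; rewrite /b; lra.
  by rewrite lerDr /g le_max lexx orbT.
apply: (@le_trans _ _ (ln (a x) + ln (2 - c))).
  rewrite -lnM ?posrE; [|lra|lra].
  by rewrite ler_ln ?posrE /b; move: bx; rewrite /b; nra.
by rewrite lerD2r /g le_max lexx.
Qed.

Lemma shift_nonconstant (e : R) :
  (P [set x | x \in I /\ (a x < xi + e)%R] < 1)%E ->
  (0 < P (S `&` [set x | (e <= b x)%R]))%E.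
Proof.
rewrite (_ : [set x | _] = S `&` [set x | a x < xi + e])// => lt1.
have mA : measurable (S `&` [set x | a x < xi + e] : set (measurableTypeR R)).
  rewrite (_ : _ `&` _ = S `&` [set x | ((EFin \o a) x < (xi + e)%:E)%E]).
    by apply: emeasurable_fun_infty_o => //; exact/measurable_EFinP.
  by apply/seteqP; split => x /=; rewrite lte_fin.
have mB : measurable (S `&` [set x | e <= b x] : set (measurableTypeR R)).
  rewrite (_ : _ `&` _ = S `&` [set x | (e%:E <= (EFin \o b) x)%E]).
    by apply: emeasurable_fun_c_infty => //; exact/measurable_EFinP.
  by apply/seteqP; split => x /=; rewrite lee_fin.
rewrite lt0e measure_ge0 andbT; apply/eqP => B0; move: lt1; apply/negP.
rewrite -leNgt -[leLHS]PS.
have : (P S <= P ((S `&` [set x | (a x < xi + e)%R]) `|`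
    (S `&` [set x | (e <= b x)%R])))%E.
  apply: le_measure; rewrite ?inE//; first exact: measurableU.
  move=> x Sx; have [ax|ax] := ltP (a x) (xi + e); first by left.
  by right; split => //=; rewrite /b; have := c_xi; lra.
move/le_trans; apply.
rewrite -[leRHS]adde0 -[X in (_ + X)%E]B0; exact: measureU2.
Qed.

Hypothesis lnb : P.-integrable S (EFin \o (fun x => ln (b x + 1))).

Local Notation opt := (optimal P S b).
Local Notation invb := (invint P S b).

(** At [t = u / (u - c + r)] the denominator [a t - u t + u] is [t (b + r)]. Thus zeros of [w]
    correspond to roots of [(u - c + r) * invint r = 1]. *)
Lemma w_shift u r m : 0 < u -> 0 < u - c + r -> 0 < m ->
  (forall x, S x -> m <= b x + r) ->
  w F I a u (u / (u - c + r)) =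
  ((u - c + r) / u * (1 - (u - c + r) * invb r))%:E.
Proof.
move=> u0 Ur m0 mr.
have rI := integrable_inv_bounded_away mS PS mb m0 mr.
set U := u - c + r.
have rI2 : P.-integrable S (EFin \o (fun x => - (U ^+ 2 / u) * (b x + r)^-1)).
  exact: integrable_EFinZl.
have cI := integrable_const mS PS (U / u).
transitivity (\int[P]_(x in S) (U / u + - (U ^+ 2 / u) * (b x + r)^-1)%:E)%E.
  apply: eq_integral => x /set_mem Sx; congr EFin; have mx := mr _ Sx.
  rewrite /U /b in mx Ur *; field.
  rewrite !gt_eqF//=; nra.
rewrite -[LHS]fineK; last first.
  by apply: integrable_fin_num => //; exact: integrable_EFinD.
congr EFin; rewrite [LHS](RintegralD mS cI rI2) Rintegral_const//.
rewrite RintegralZl// -/(invint P S b r).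
by field; rewrite gt_eqF.
Qed.

(** [invint_root] provides a zero of [w], so [preoptimal] is one. The shift read off from it solves
    the root equation, and [nonpositive_root] shows that it is positive. *)
Lemma preoptimal_optimal u : 0 < u ->
  ((\int[P]_(x in S) ((b x)%:E)^-1)^-1 < (u - c)%:E)%E ->
  ((u - c)%:E < \int[P]_(x in S) (b x)%:E)%E ->
  exists2 r, opt (u - c) r & preoptimal F I a u = u / (u - c + r).
Proof.
move=> u0 kU Ub; have c0 := c_le0; have cxi := c_xi.
have U0 : 0 < u - c by lra.
(* If [u <= xi], then [b >= u - c] on the whole interval, so the integral of [1 / b] is at most
   [1 / (u - c)], against [kU]. *)
have xiu : xi < u.
  rewrite ltNge; apply/negP => uxi; move: kU; apply/negP; rewrite -leNgt.
  rewrite inve_pge ?inE ?lee_fin ?(ltW U0) ?integral_inve_ge0//.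
  rewrite inver gt_eqF//.
  rewrite -(integral_EFin_const mS PS (u - c)^-1).
  apply: ge0_le_integral => //.
  - by move=> x Sx; rewrite inve_ge0 lee_fin b_ge0.
  - exact: measurable_fun_inve.
  move=> x Sx; have := xi_le Sx => ax; rewrite inver gt_eqF; last by rewrite /b; lra.
  by rewrite lee_fin lef_pV2 ?posrE /b; lra.
have [r0 r00 kr0] := invint_root mS PS mb b_ge0 U0 kU Ub.
have ex : exists t, [set t | 0 < t < u / (u - xi) /\ w F I a u t = 0%E] t.
  exists (u / (u - c + r0)); split.
    rewrite divr_gt0//=; last lra.
    by rewrite ltr_pM2l// ltf_pV2 ?posrE; lra.
  rewrite (w_shift u0 _ r00); [|lra|by move=> x /b_ge0; lra].
  by rewrite kr0 subrr mulr0.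
have := xgetPex 0 ex; rewrite -/(preoptimal F I a u) => -[/andP[t0 tlt] wt].
set t := preoptimal F I a u in t0 tlt wt *.
pose r := u / t - (u - c).
have tE : t = u / (u - c + r).
  by rewrite /r addrC subrK invf_div mulrCA divff ?mulr1// gt_eqF.
have Ur : 0 < u - c + r by rewrite /r addrC subrK divr_gt0.
(* The upper limit [u / (u - xi)] on [t] keeps [b + r] away from 0, even if [r] is negative. *)
have m0 : 0 < xi - c + r.
  move: tlt; rewrite tE ltr_pM2l// ltf_pV2 ?posrE ?subr_gt0//; lra.
have mr x : S x -> xi - c + r <= b x + r.
  by move=> Sx; rewrite lerD2r /b lerD2r xi_le.
have kr : (u - c + r) * invb r = 1.
  move: wt; rewrite tE (w_shift u0 Ur m0 mr) => -[] /eqP.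
  rewrite mulf_eq0 gt_eqF ?divr_gt0//= subr_eq0 => /eqP <-//.
exists r => //; apply: root_optimal => //.
rewrite ltNge; apply/negP => rle0; move: kU; apply/negP; rewrite -leNgt.
exact: (nonpositive_root mS PS mb b_ge0 U0 rle0 Ur m0 mr kr).
Qed.

(** In both regimes the first branch of [tbar] is the case [u - c <= 1 / H'], with [H'] the extended
    integral of [1 / b]; it corresponds to the shift 0. *)
Lemma tbar_optimal u : (0 < u%:E < E)%E ->
  exists2 r, opt (u - c) r & tb u = u / (u - c + r).
Proof.
move=> /andP[]; rewrite lte_fin => u0 uE; have c0 := c_le0.
have U0 : 0 < u - c by lra.
have Ub : ((u - c)%:E < \int[P]_(x in S) (b x)%:E)%E.
  move: uE; rewrite mean_shift EFinB.
  by rewrite lteBlDr.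
have cE : c = if 0 <= xi then 0 else xi.
  by rewrite /c /xi_min0; case: (leP 0 xi).
have opt0 : ((u - c)%:E <= (\int[P]_(x in S) ((b x)%:E)^-1)^-1)%E -> opt (u - c) 0.
  exact: (optimal0 mS mb b_ge0 lnb U0).
rewrite /tb /tbar -/xi uE; case: ifPn => xi0 in cE *.
  have HE : H F I a = (\int[P]_(x in S) ((b x)%:E)^-1)%E.
    by apply: eq_integral => x _; rewrite /b cE subr0.
  rewrite HE; case: ifPn => [uH|]; last rewrite -ltNge => uH.
    exists 0; first by apply: opt0; rewrite {1}cE subr0.
    by rewrite cE subr0 addr0 divff// gt_eqF.
  by apply: preoptimal_optimal => //; rewrite cE subr0.
have HE : Hxi F I a = (\int[P]_(x in S) ((b x)%:E)^-1)%E.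
  by apply: eq_integral => x _; rewrite /b cE.
rewrite /threshold HE -/xi; case: ifPn => [|]; last rewrite -ltNge gt_max.
  (* As [u > 0], it cannot be the 0 in [threshold] that bounds [u]. *)
  rewrite le_max => /orP[|uH]; first by rewrite lee_fin leNgt u0.
  exists 0; last by rewrite cE addr0.
  by apply: opt0; rewrite EFinB leeBlDl// cE.
move=> /andP[_ uH]; apply: preoptimal_optimal => //.
by rewrite EFinB lteBrDl// cE.
Qed.

Lemma G_shift u r : 0 < u -> 0 < u - c + r ->
  admissible P S b r ->
  G F I a u (u / (u - c + r)) =
  (expR (logint P S b r - ln (u - c + r)))%:E.
Proof.
move=> u0 Ur ra; rewrite /G -[RHS]/(expeR (_%:E)).
rewrite -(integral_lne_div mS PS mb ra Ur); congr expeR.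
apply: eq_integral => x _; congr (lne _%:E); rewrite /b.
by field; rewrite !gt_eqF.
Qed.

(** The formula of [G_shift] continued to [u = 0], with [eta] in the role of [t / u]. *)
Lemma growth_sup_shift r : 0 < - c + r -> admissible P S b r ->
  growth_sup F I a (- c + r)^-1 =
  (expR (logint P S b r - ln (- c + r)))%:E.
Proof.
move=> cr ra; rewrite /growth_sup -[RHS]/(expeR (_%:E)).
rewrite -(integral_lne_div mS PS mb ra cr); congr expeR.
apply: eq_integral => x _; congr (lne _%:E); rewrite /b.
by field; rewrite gt_eqF.
Qed.
End game_facts.

(** * Continuity, monotonicity and range of the optimal growth factor *)

Theorem theorem4p1 (R : realType) (F : cumulativeBounded (0 : R) (1 : R))
    (I : interval R) (a : R -> R)
    (P := lebesgue_stieltjes_measure F)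
    (xi := Defs.xi I a) (E := mean F I a) (D := price_domain F I a)
    (tb := tbar F I a) (GG := fun u => G F I a u (tb u)) :
  P [set` I] = 1%E ->
  measurable_fun [set` I] a ->
  has_lbound (a @` [set` I]) ->
  (forall eps, 0 < eps ->
    (0 < P [set x | x \in I /\ (a x < xi + eps)%R])%E) ->
  (exists2 delta, 0 < delta &
    (P [set x | x \in I /\ (a x < xi + delta)%R] < 1)%E) ->
  (0 < E)%E ->
  (\int[P]_(x in [set x | x \in I /\ (1 < a x)%R]) (ln (a x))%:E < +oo)%E ->
  [/\ {within D, continuous GG},
      {in D &, forall u v : R, u < v -> (GG v < GG u)%E},
      0 <= xi -> GG @` D = [set y | (1 < y < +oo)%E] &
      xi < 0 ->
        cvg (tb u / u @[u --> 0^'+]) /\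
        let eta := lim (tb u / u @[u --> 0^'+]) in
        GG @` D = [set y | (1 < y < growth_sup F I a eta)%E] ].
Proof.
move=> PS ma a_lb _ [e e0 Pe] E0 lnoo.
pose c := xi_min0 I a; pose b x := a x - c.
pose mu : {measure set _ -> \bar R} := lebesgue_stieltjes_measure F.
have mS : measurable ([set` I] : set (measurableTypeR R)) by exact: measurable_itv.
have mb : measurable_fun [set` I] b by exact: measurable_funB.
have c_le0 : c <= 0 by rewrite /c /xi_min0 ge_min lexx orbT.
have c_xi : c <= xi by rewrite /c /xi_min0 ge_min lexx.
have b_ge0 x : [set` I] x -> 0 <= b x.
  by move=> Ix; rewrite subr_ge0 (le_trans c_xi)// xi_le.
have lnb := integrable_ln1p_shift PS ma a_lb lnoo.
have Eb := mean_shift PS ma a_lb.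
(* Inverting [tb u = u / (u - c + r)] turns the shift given at each price by [tbar_optimal] into a
   function of [u]. *)
pose r u := u / tb u - (u - c).
have domE : D = [set u | (0 < u%:E < \int[mu]_(x in [set` I]) (b x)%:E + c%:E)%E].
  by rewrite -Eb.
have D_gt0 u : D u -> 0 < u by move=> /andP[]; rewrite lte_fin.
have tb_opt u : D u ->
    optimal mu [set` I] b (u - c) (r u) /\ tb u = u / (u - c + r u).
  move=> Du; have u0 := D_gt0 _ Du.
  have [s so st] := tbar_optimal PS ma a_lb lnb Du.
  have [[s0 _ _] _ _ _] := so.
  suff -> : r u = s by [].
  by rewrite /r /tb st invf_div mulrCA divff ?gt_eqF// mulr1 [u - c + s]addrC addrK.
have ropt u : D u -> optimal mu [set` I] b (u - c) (r u).
  by move=> Du; case: (tb_opt _ Du).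
have Ur u : D u -> 0 < u - c + r u.
  by move=> Du; have := D_gt0 _ Du; have [[s0 _ _] _ _ _] := ropt _ Du; lra.
pose v u := logint mu [set` I] b (r u) - ln (u - c + r u).
have GE u : D u -> GG u = (expR (v u))%:E.
  move=> Du; have [[ra _ _ _] tE] := tb_opt _ Du.
  by rewrite /GG tE; apply: G_shift => //; [exact: D_gt0|exact: Ur].
have E0b : (0 < \int[mu]_(x in [set` I]) (b x)%:E + c%:E)%E by rewrite -Eb.
have Dopen : open D by rewrite domE; exact: dom_open.
have vC : {in D, continuous v}.
  by move: ropt; rewrite domE => ropt; apply: value_continuous.
have vlt u w : D u -> D w -> u < w -> v w < v u.
  by move: ropt; rewrite domE => ropt; exact: (value_lt mS PS c_le0 ropt).
have v0 u : D u -> 0 < v u.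
  by move: ropt; rewrite domE => ropt; exact: (value_gt0 mS PS c_le0 ropt).
have vonto y : 0 < y -> (exists2 u, D u & y <= v u) -> exists2 u, D u & v u = y.
  move: ropt; rewrite domE => ropt y0.
  exact: (value_onto mS PS mb b_ge0 lnb c_le0 E0b ropt y0).
have range (y : R) : 1 < y -> (exists2 u, D u & ln y <= v u) -> (GG @` D) y%:E.
  move=> y1 uy; have [u Du vu] := vonto _ (ln_gt0 y1) uy.
  by exists u => //; rewrite GE// vu lnK// posrE; lra.
split.
- rewrite continuous_open_subspace// => u /[dup] /set_mem Du uD.
  rewrite /continuous_at GE//.
  apply: cvg_trans (_ : (expR (v s))%:E @[s --> u] --> _).
    apply: near_eq_cvg; have : \forall s \near u, D s.
      exact: (open_nbhs_nbhs (conj Dopen Du)).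
    by apply: filterS => s Ds; rewrite GE.
  apply: cvg_EFin; first exact: nearW.
  by apply: continuous_cvg; [exact: continuous_expR|exact: vC].
- by move=> u w /set_mem Du /set_mem Dw uw; rewrite !GE// lte_fin ltr_expR vlt.
- move=> xi0; have c0 : c = 0.
    by rewrite /c /xi_min0; case: (leP 0 _) xi0 => //; rewrite leNgt => ->.
  apply/seteqP; split => [_ [u Du <-]|[y| |]].
  + by rewrite GE//= ltry andbT lte_fin expR_gt1 v0.
  + rewrite /= lte_fin ltry andbT => y1; apply: range => //.
    move: ropt; rewrite domE => ropt.
    apply: (value_unbounded mS PS mb b_ge0 lnb E0b ropt c0 e0).
    exact: shift_nonconstant.
  + by rewrite /= ltxx andbF.
  + by move=> /andP[].
- move=> xi0; have c0 : c < 0.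
    by rewrite /c /xi_min0 gt_min xi0.
  have [r0 [rlim r0a vlt_sup vsup]] : exists r0, [/\ r u @[u --> 0^'+] --> r0,
      admissible mu [set` I] b r0,
      forall u, D u -> v u < logint mu [set` I] b r0 - ln (- c + r0) &
      forall y, y < logint mu [set` I] b r0 - ln (- c + r0) ->
        exists2 u, D u & y <= v u].
    move: ropt; rewrite domE => ropt.
    exact: (path_limit mS PS mb b_ge0 lnb c_le0 E0b ropt c0).
  have [r0_ge0 _ _] := r0a.
  have cr0 : 0 < - c + r0 by lra.
  (* On [D], [tb u / u] is [(u - c + r u)^-1], so [eta] is the inverse of [- c + r0], which is
     positive because [c < 0]. *)
  have tlim : tb u / u @[u --> 0^'+] --> (- c + r0)^-1.
    have [p Dp] : exists p, D p by rewrite domE; exact: dom_nonempty.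
    apply: cvg_trans (_ : (u - c + r u)^-1 @[u --> 0^'+] --> _).
      apply: near_eq_cvg; near=> u.
      have u0 : 0 < u by near: u; exact: nbhs_right_gt.
      have Du : D u.
        have up : u <= p by near: u; apply: nbhs_right_le; exact: D_gt0.
        rewrite /D /price_domain/= lte_fin u0/=.
        by have /andP[_] := Dp; apply: le_lt_trans; rewrite lee_fin.
      have [_ ->] := tb_opt _ Du.
      by rewrite mulrAC divff ?mul1r// gt_eqF.
    apply: cvgV; first by rewrite gt_eqF.
    apply: cvgD => //; rewrite -[X in _ --> X]add0r.
    by apply: cvgB; [exact: cvg_at_right_filter|exact: cvg_cst].
  split; first by apply/cvg_ex; exists (- c + r0)^-1.
  rewrite /= (cvg_lim _ tlim)//.
  rewrite (growth_sup_shift PS ma cr0 r0a).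
  apply/seteqP; split => [_ [u Du <-]|[y| |]].
  + by rewrite GE//= !lte_fin expR_gt1 ltr_expR v0//= vlt_sup.
  + rewrite /= !lte_fin => /andP[y1 ylt]; apply: range => //.
    by apply: vsup; rewrite -ltr_expR lnK// posrE; lra.
  + by move=> /andP[].
  + by move=> /andP[].
Unshelve. all: by end_near. Qed.
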